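(* Let $n\ge 2$ and for a partition $\nu\vdash m$ let $C(\nu)$ denote the number of pair partitions of $\{1,\dots,2m\}$ of coset-type $\nu$. For every partition $\lambda\vdash n$, $$C(\lambda)=\sum_{\substack{\mu\subset\lambda\\ \mu\vdash n-1}}\mu^{\lambda}\,C(\mu),$$ where the sum is over partitions $\mu$ of $n-1$ whose Young diagram is contained in that of $\lambda$, and $\mu^\lambda$ is defined as follows: let $i$ be the unique row index with $\lambda_i=\mu_i+1$ (where $\mu_i:=0$ if $i>\ell(\mu)$), set $\mu_-=\mu_i$, and let $m_{\mu_-}$ be the number of parts of $\mu$ equal to $\mu_-$; then $\mu^\lambda=2\mu_-m_{\mu_-}$ if $\mu_->0$ and $\mu^\lambda=1$ if $\mu_-=0$.
   Context: A pair partition of $\{1,\dots,2m\}$ is a set partition of $\{1,\dots,2m\}$ into $m$ blocks of size $2$. For a pair partition $\sigma$, let $\Gamma(\sigma)$ be the multigraph on vertex set $\{1,\dots,2m\}$ whose edges are the $m$ pairs $\{2k-1,2k\}$ ($k=1,\dots,m$) together with the $m$ blocks of $\sigma$ (an edge may appear twice). Every vertex has degree $2$, so each connected component has an even number $2k$ of vertices; the coset-type of $\sigma$ is the partition of $m$ whose parts are the numbers $k$ (half the number of vertices) of the connected components of $\Gamma(\sigma)$, arranged in decreasing order. For a partition $\mu$, $\ell(\mu)$ is its number of nonzero parts. *)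

(* Defs.v *)
From HB Require Import structures.
From mathcomp Require Import all_boot all_order.

Set Implicit Arguments.
Unset Strict Implicit.
Unset Printing Implicit Defensive.

Definition is_intpart (n : nat) (s : seq nat) : bool :=
  [&& sorted geq s, 0 \notin s & sumn s == n].

Record intpart (n : nat) : predArgType :=
  IntPart { parts :> seq nat; intpartP : is_intpart n parts }.

HB.instance Definition _ n := [isSub for @parts n].
HB.instance Definition _ n := [Countable of intpart n by <:].

Lemma is_intpart_bounds n s :
  is_intpart n s -> (size s <= n) && all (fun k => k < n.+1) s.
Proof.
case/and3P=> _ s0 /eqP <-; apply/andP; split.
  elim: s s0 => //= k s IHs; rewrite inE negb_or eq_sym -lt0n.
  by case/andP=> k0 /IHs; rewrite -add1n => /(leq_add k0).
apply/allP=> k; rewrite ltnS; elim: s {s0} => //= j s IHs.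
rewrite inE => /orP[/eqP->|/IHs]; first exact: leq_addr.
by move/leq_trans; apply; apply: leq_addl.
Qed.

Definition intpart_code n (p : intpart n) : n.-bseq 'I_n.+1 :=
  insub_bseq n [seq inord k | k <- parts p].

Definition intpart_decode n (b : n.-bseq 'I_n.+1) : option (intpart n) :=
  insub [seq val k | k <- b].

Lemma intpart_codeK n : pcancel (@intpart_code n) (@intpart_decode n).
Proof.
move=> p; rewrite /intpart_decode /intpart_code.
have /andP[szp /allP ltp] := is_intpart_bounds (intpartP p).
rewrite /insub_bseq insubdK; last by rewrite -topredE /= size_map.
rewrite -map_comp (_ : map _ _ = val p) ?valK //.
by apply: map_id_in => k /ltp; apply: inordK.
Qed.

HB.instance Definition _ n : isFinite (intpart n) :=
  PCanIsFinite (@intpart_codeK n).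

(** Rows and columns are numbered from 0; [nth 0 s i] is the [i]-th part of [s],
    equal to 0 beyond the last part. *)
Definition diagram (s : seq nat) : seq (nat * nat) :=
  [seq (i, j) | i <- iota 0 (size s), j <- iota 0 (nth 0 s i)].

Definition diag_sub (mu la : seq nat) : bool :=
  all [in diagram la] (diagram mu).

(** The first row [i] with [la_i = mu_i + 1]; it is the only one when
    [diag_sub mu la] and [sumn la = (sumn mu).+1]. *)
Definition added_row (mu la : seq nat) : nat :=
  find (fun i => nth 0 la i == (nth 0 mu i).+1) (iota 0 (size la)).

Definition mult (mu la : seq nat) : nat :=
  let mu_minus := nth 0 mu (added_row mu la) in
  if 0 < mu_minus then 2 * mu_minus * count_mem mu_minus mu else 1.

Definition pair_partition m (sigma : {set {set 'I_m.*2}}) : bool :=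
  [&& partition sigma [set: 'I_m.*2], #|sigma| == m
    & [forall B in sigma, #|B| == 2]].

(** With points numbered from 0, the pairs {2k-1, 2k}, k = 1..m, become
    {2k, 2k+1}, k = 0..m-1. *)
Definition base_pair m (k : 'I_m) : {set 'I_m.*2} :=
  [set x : 'I_m.*2 | (x == k.*2 :> nat) || (x == k.*2.+1 :> nat)].

(** The multigraph is given by its list of edges, in which an edge may occur
    twice. *)
Definition Gamma m (sigma : {set {set 'I_m.*2}}) : seq {set 'I_m.*2} :=
  [seq base_pair k | k <- enum 'I_m] ++ enum sigma.

Definition adjacent m (sigma : {set {set 'I_m.*2}}) : rel 'I_m.*2 :=
  fun x y => [set x; y] \in Gamma sigma.

Definition components m (sigma : {set {set 'I_m.*2}}) : {set {set 'I_m.*2}} :=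
  [set [set y | connect (adjacent sigma) x y] | x : 'I_m.*2].

Definition coset_type m (sigma : {set {set 'I_m.*2}}) : seq nat :=
  sort geq [seq #|K|./2 | K : {set 'I_m.*2} in components sigma].

Definition C m (nu : intpart m) : nat :=
  #|[set sigma : {set {set 'I_m.*2}} |
      pair_partition sigma && (coset_type sigma == nu)]|.

(* Main.v *)
Require Import Defs.
From mathcomp Require Import all_boot all_order zify.

Set Implicit Arguments.
Unset Strict Implicit.
Unset Printing Implicit Defensive.

(** A pair partition of the [2n] points is a fixed-point-free involution [s].
    Deleting the last base pair [{p, q}], and joining the partners of [p] and
    [q] when these are not [p] and [q] themselves, turns [s] into an involution
    [s'] of the remaining points.  Conversely [s] is recovered from [s'] and
    either the information that [p] is matched with [q], or the partner [x] of
    [p], which can be any of the remaining points.  The insertion creates a part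
    1 in the first case, and turns the half-size [k] of the component of [x]
    into [k + 1] in the second one.  If [s'] has coset-type [mu], exactly
    [2 k m_k(mu)] points [x] lie in components of half-size [k], which is the
    weight of [mu] in the sum. *)

(** * Growing a part of a partition *)

Lemma diag_subP (mu la : seq nat) :
  reflect (forall i, nth 0 mu i <= nth 0 la i) (diag_sub mu la).
Proof.
apply: (iffP allP) => [sub i | le_ij [i j]].
  case E: (nth 0 mu i) => [//|k].
  have ltim : i < size mu by rewrite ltnNge; apply/negP => /(nth_default 0); rewrite E.
  have /sub/allpairsPdep[i' [j' [_ + [-> ->]]]] : (i, k) \in diagram mu.
    apply/allpairsPdep; exists i, k.
    by rewrite !mem_iota /= !add0n E ltim ltnSn.
  by rewrite mem_iota.
case/allpairsPdep => i' [j' []]; rewrite !mem_iota /= !add0n => _ ltj [-> ->].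
have ltjl := leq_trans ltj (le_ij i').
apply/allpairsPdep; exists i', j'; rewrite !mem_iota /= !add0n ltjl.
by split=> //; rewrite ltnNge; apply/negP => /(nth_default 0) E; rewrite E in ltjl.
Qed.

(** Padding with zero rows lets partitions of different lengths be summed over one common range. *)
Lemma sumn_nth (s : seq nat) n : size s <= n -> sumn s = \sum_(i < n) nth 0 s i.
Proof.
move=> sz; rewrite sumnE (big_nth 0) big_mkord (big_ord_widen n (nth 0 s)) //.
rewrite [RHS](bigID (fun i : 'I_n => i < size s)) /= [X in _ + X]big1 ?addn0 //.
by move=> i; rewrite -leqNgt; apply: nth_default.
Qed.

Lemma eq_from_nth_pos (s1 s2 : seq nat) :
  0 \notin s1 -> 0 \notin s2 -> (forall i, nth 0 s1 i = nth 0 s2 i) -> s1 = s2.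
Proof.
move=> s10 s20 e; apply: (@eq_from_nth _ 0) => [|i _]; last exact: e.
have le s s' : 0 \notin s -> (forall i, nth 0 s i = nth 0 s' i) -> size s <= size s'.
  move=> s0 e'; rewrite leqNgt; apply: contra s0 => lt.
  by rewrite -(nth_default 0 (leqnn (size s'))) -e' mem_nth.
by apply/eqP; rewrite eqn_leq !le.
Qed.

Lemma notin0_incr_nth (s : seq nat) i :
  i <= size s -> 0 \notin s -> 0 \notin incr_nth s i.
Proof.
elim: s i => [|x s IHs] [|i] //=; rewrite !inE !negb_or => lei /andP[x0 s0] //.
by rewrite x0 IHs.
Qed.

(** Stated additively to avoid truncated subtraction. The case [i = size s] appends a part 1: the
    default 0 of [nth] is then the part being raised, and it goes uncounted because [j] is
    positive. *)
Lemma count_incr_nth (s : seq nat) i j :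
  i <= size s -> 0 < j ->
  count_mem j (incr_nth s i) + (nth 0 s i == j)
    = count_mem j s + ((nth 0 s i).+1 == j).
Proof.
elim: s i => [|x s IHs] [|i] //=; [lia | lia |].
by rewrite ltnS => lei j0; rewrite -!addnA IHs.
Qed.

Lemma mem_incr_nth (s : seq nat) i y :
  i <= size s -> y \in incr_nth s i -> y = (nth 0 s i).+1 \/ y \in s.
Proof.
elim: s i => [|x s IHs] [|i] //=; rewrite ?inE => lei.
- by move/eqP; left.
- by case/orP=> [/eqP|->]; [left | right; rewrite orbT].
case/orP=> [->|/(IHs _ lei)[->|->]]; [by right | by left | by right; rewrite orbT].
Qed.

(** [index k s] is the topmost row of length [k], so every row above it is strictly longer. For
    [k = 0] it equals [size s], and a new bottom row is opened. *)
Lemma sorted_incr_nth (s : seq nat) k :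
  sorted geq s -> 0 \notin s -> k = 0 \/ k \in s ->
  sorted geq (incr_nth s (index k s)).
Proof.
have geq_tr : transitive geq by move=> y x z /= xy yz; apply: leq_trans yz xy.
elim: s => //= x s IHs; rewrite !path_sortedE // inE negb_or.
case/andP=> xs ss /andP[x0 s0] kP.
have [xk|nxk] := eqVneq x k; rewrite /= path_sortedE //.
  rewrite ss andbT; apply/allP => y /(allP xs) /= yx; exact: leqW.
have {}kP : k = 0 \/ k \in s.
  by case: kP => [|]; [left | rewrite inE eq_sym (negPf nxk); right].
rewrite (IHs ss s0 kP) andbT; apply/allP => y; rewrite /geq /=.
case/(mem_incr_nth (index_size k s)) => [->|/(allP xs)//].
case: kP => [k0|ks].
  by rewrite k0 nth_default ?lt0n ?(eq_sym x) // memNindex.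
by rewrite nth_index // ltn_neqAle eq_sym nxk; apply: (allP xs).
Qed.

Lemma sorted_count_eq (s1 s2 : seq nat) :
  sorted geq s1 -> sorted geq s2 -> 0 \notin s1 -> 0 \notin s2 ->
  (forall j, 0 < j -> count_mem j s1 = count_mem j s2) -> s1 = s2.
Proof.
move=> st1 st2 s10 s20 e; apply: (sorted_eq (leT := geq)) => //.
- by move=> y x z /= xy yz; apply: leq_trans yz xy.
- by move=> x y /=; rewrite andbC -eqn_leq => /eqP.
apply/allP => -[|j] _ /=; last by rewrite e.
by rewrite (count_memPn s10) (count_memPn s20).
Qed.

(* [la] arises from [mu] by turning a part [k] into [k + 1], or by creating a
   part 1 when [k = 0]. *)
Definition grown (k : nat) (mu la : seq nat) : Prop :=
  forall j, 0 < j ->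
    count_mem j la + (k == j) = count_mem j mu + (k.+1 == j).

Lemma added_row_incr_nth (mu : seq nat) i :
  i <= size mu -> 0 \notin mu -> added_row mu (incr_nth mu i) = i.
Proof.
move=> lei mu0; rewrite /added_row.
set a := fun _ => _.
have aE l : a l = (l == i).
  rewrite /a nth_incr_nth [RHS]eq_sym; case: (i == l) => /=.
    by rewrite add1n eqxx.
  by rewrite add0n ltn_eqF.
have lt : i < size (incr_nth mu i) by rewrite size_incr_nth; case: (ltnP i (size mu)).
rewrite (eq_find aE) -[find _ _]/(index i _).
by rewrite -[X in index X _](nth_iota 0 0 lt) index_uniq ?size_iota ?iota_uniq.
Qed.

(** Translates growth, expressed by multiplicities, into the diagram language of the weight.
    Multiplicities determine a partition, so [la] must be [mu] with its topmost part [k] raised;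
    conversely, two nested diagrams whose sizes differ by 1 differ in a single row. *)
Lemma grownP n (mu : intpart n) (la : intpart n.+1) k :
  grown k mu la <-> diag_sub mu la /\ nth 0 mu (added_row mu la) = k.
Proof.
have /and3P[mus mu0 /eqP muS] := intpartP mu.
have /and3P[las la0 /eqP laS] := intpartP la.
split=> [gr|].
  have kP : k = 0 \/ k \in (mu : seq nat).
    case: k gr => [|k] gr; [by left | right].
    (* At [j = k.+1] the left-hand side is positive and the correction on the right vanishes, so
       [k.+1] occurs in [mu]. *)
    have := gr k.+1 isT; rewrite eqxx addn1 gtn_eqF // addn0 => e.
    by rewrite -has_pred1 has_count -e.
  have nk : nth 0 mu (index k mu) = k.
    case: kP => [->|km]; last exact: nth_index.
    by rewrite nth_default // memNindex.
  have laE : parts la = incr_nth mu (index k mu).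
    apply: sorted_count_eq => //; first exact: sorted_incr_nth.
      by apply: notin0_incr_nth; rewrite ?index_size.
    move=> j j0; apply/eqP; rewrite -(eqn_add2r (k == j)) gr //.
    by rewrite -{3}nk count_incr_nth ?index_size // nk.
  rewrite laE added_row_incr_nth ?index_size // nk; split=> //.
  by apply/diag_subP => i; rewrite nth_incr_nth leq_addl.
case=> /diag_subP le_ml <-.
have [i laE] : exists i, forall l, nth 0 la l = (i == l) + nth 0 mu l.
  pose N := maxn (size mu) (size la).
  (* The row differences are natural numbers with sum 1: one of them is 1 and all others are 0. *)
  have : \sum_(l < N) (nth 0 la l - nth 0 mu l) = 1.
    by rewrite sumnB // -!sumn_nth ?leq_maxl ?leq_maxr // muS laS subSnn.
  move/eqP/sum_nat_eq1 => [i [_ i1 i0]].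
  exists (val i) => l; case: (ltnP l N) => [ltl|lel].
    case: (eqVneq (val i) l) => [<-|neq]; first by have := le_ml (val i); move: i1 => /=; lia.
    have := i0 (Ordinal ltl); rewrite -val_eqE /= eq_sym neq => /(_ isT isT).
    by have := le_ml l; lia.
  rewrite !nth_default ?(leq_trans _ lel) ?leq_maxl ?leq_maxr //.
  by rewrite ltn_eqF // (leq_trans (ltn_ord i)).
(* If the new box lay further down, row [size mu] of [la] would be an empty row above a nonempty
   one, that is, a zero part. *)
have lei : i <= size mu.
  rewrite leqNgt; apply/negP => lt.
  have : 0 \in (la : seq nat); last exact: (negP la0).
  have -> : 0 = nth 0 la (size mu) by rewrite laE nth_default // gtn_eqF.
  apply: mem_nth; rewrite ltnNge; apply/negP => le.
  by have := laE i; rewrite !nth_default ?eqxx // ltnW // (leq_ltn_trans le).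
have -> : parts la = incr_nth mu i.
  apply: eq_from_nth_pos => // [|l]; first exact: notin0_incr_nth.
  by rewrite nth_incr_nth laE.
by rewrite added_row_incr_nth // => j j0; rewrite count_incr_nth.
Qed.

(** * Fixed-point-free involutions and their components *)

Definition fpf_inv (T : finType) (s : T -> T) : bool :=
  [forall x, (s x != x) && (s (s x) == x)].

Lemma fpf_invP (T : finType) (s : T -> T) :
  reflect ((forall x, s x != x) /\ involutive s) (fpf_inv s).
Proof.
apply: (iffP forallP) => [h | [h1 h2] x]; last by rewrite h1 h2 eqxx.
by split=> x; have /andP[? /eqP] := h x.
Qed.

Lemma eq_fpf_inv (T : finType) (s1 s2 : T -> T) :
  s1 =1 s2 -> fpf_inv s1 = fpf_inv s2.
Proof. by move=> e; apply: eq_forallb => x; rewrite !e. Qed.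

(** Orient each pair by [enum_rank]: [t] exchanges the lower and the upper ends of the pairs inside
    [K], so there are equally many of both. *)
Lemma fpf_inv_even (T : finType) (t : T -> T) (K : {set T}) :
  fpf_inv t -> (forall x, x \in K -> t x \in K) -> odd #|K| = false.
Proof.
move=> /fpf_invP[tN tK] Kt.
pose E := [set x | enum_rank x < enum_rank (t x)].
have -> : #|K| = #|K :&: E| + #|K :&: E|.
  rewrite -{1}(cardsID E K) -(card_imset (mem (K :&: E)) (can_inj tK)).
  congr (_ + _); apply: eq_card => x; apply/idP/imsetP.
    rewrite !inE -leqNgt => /andP[le xK]; exists (t x); rewrite ?tK //.
    rewrite !inE Kt // tK /= ltn_neqAle le andbT; apply/eqP => /ord_inj/enum_rank_inj.
    by apply/eqP.
  case=> y; rewrite !inE => /andP[yK lty] ->.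
  by rewrite tK Kt // andbT -leqNgt ltnW.
by rewrite addnn odd_double.
Qed.

Lemma connect_homo (T T' : finType) (e : rel T) (e' : rel T') (f : T -> T') :
  (forall x y, e x y -> connect e' (f x) (f y)) ->
  forall x y, connect e x y -> connect e' (f x) (f y).
Proof.
move=> fe x y /connectP[p + ->]; elim: p x => [|z p IHp] x //=.
by case/andP=> /fe xz /IHp; apply: connect_trans.
Qed.

(** The multigraph as a union of two perfect matchings, each encoded by its involution: [t] for the
    base pairs, [s] for the pair partition. Double edges do not affect connectivity. *)
Definition edge (T : finType) (t s : T -> T) : rel T :=
  [rel x y | (y == t x) || (y == s x)].

Definition ctype (T : finType) (t s : T -> T) : seq nat :=
  sort geq [seq #|K|./2 |
    K : {set T} in [set [set y | connect (edge t s) x y] | x : T]].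

Lemma eq_ctype (T : finType) (t s1 s2 : T -> T) :
  s1 =1 s2 -> ctype t s1 = ctype t s2.
Proof.
move=> e; rewrite /ctype; congr (sort _ [seq _ | _ in pred_of_set _]).
apply: eq_imset => x; apply/setP => y; rewrite !inE.
by apply: eq_connect => u v; rewrite /edge /= e.
Qed.

Section Components.
Variables (T : finType) (t s : T -> T).
Hypotheses (tP : fpf_inv t) (sP : fpf_inv s).

Local Notation e := (edge t s).
Local Notation class x := [set y | connect e x y].
Local Notation comps := [set class x | x : T].

Lemma edge_sym : symmetric e.
Proof.
have [_ tK] := fpf_invP _ tP; have [_ sK] := fpf_invP _ sP.
by move=> x y; rewrite /edge /= !(eq_sym y) (can2_eq tK tK) (can2_eq sK sK).
Qed.

Lemma connect_edge_sym : connect_sym e.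
Proof. exact/sym_connect_sym/edge_sym. Qed.

Lemma class_eqP x y : reflect (class x = class y) (connect e x y).
Proof.
apply: (iffP idP) => [xy | eq]; last first.
  by have : y \in class x; [rewrite eq inE connect0 | rewrite inE].
by apply/setP => z; rewrite !inE (same_connect connect_edge_sym xy).
Qed.

Lemma class_even K : K \in comps -> odd #|K| = false.
Proof.
case/imsetP=> x _ ->; apply: (fpf_inv_even tP) => y; rewrite !inE => xy.
by apply: connect_trans xy (connect1 _); rewrite /edge /= eqxx.
Qed.

Lemma class_pos K : K \in comps -> 0 < #|K|./2.
Proof.
move=> KC; have := class_even KC; case/imsetP: KC => x _ ->.
by have : 0 < #|class x| by [apply/card_gt0P; exists x; rewrite inE connect0]; lia.
Qed.

Lemma sorted_ctype : sorted geq (ctype t s).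
Proof. by apply: sort_sorted => x y /=; apply: leq_total. Qed.

Lemma ctype_pos : 0 \notin ctype t s.
Proof.
rewrite mem_sort; apply/negP => /imageP[K /class_pos + e0].
by rewrite -e0.
Qed.

Lemma mem_class K x : K \in comps -> (x \in K) = (class x == K).
Proof.
case/imsetP=> y _ ->; rewrite inE connect_edge_sym.
by apply/idP/eqP => [/class_eqP|/class_eqP].
Qed.

(** Points are counted class by class. *)
Lemma card_class_sum (P : pred nat) :
  #|[set x | P #|class x|]| = \sum_(K in comps | P #|K|) #|K|.
Proof.
rewrite -sum1dep_card.
rewrite (partition_big (fun x => class x) (fun K => (K \in comps) && P #|K|)) /=.
  apply: eq_bigr => K /andP[KC PK]; rewrite sum1dep_card; apply: eq_card => x.
  by rewrite inE [RHS]mem_class // andbC; case: eqP => // ->.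
by move=> x ->; rewrite imset_f.
Qed.

(** Multiplicities of the coset-type become counts of points, which are easier to follow under
    insertion and relabelling than counts of classes. Evenness of the classes makes half-size [j]
    the same as size [j.*2]. *)
Lemma count_ctype j :
  #|[set x | #|class x| == j.*2]| = j.*2 * count_mem j (ctype t s).
Proof.
rewrite /ctype (permP (permEl (perm_sort _ _))) count_map -sum1_count big_enum_cond /=.
rewrite (card_class_sum (fun k => k == j.*2)) big_distrr /=.
apply: eq_big => [K|K /andP[_ /eqP->]]; last by rewrite muln1.
by case KC: (K \in comps) => //=; have := class_even KC; lia.
Qed.

Lemma sumn_ctype : sumn (ctype t s) = #|T|./2.
Proof.
rewrite /ctype sumnE (perm_big _ (permEl (perm_sort _ _))) big_map big_enum /=.
apply: double_inj; rewrite even_halfK; last first.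
  by rewrite -cardsT (fpf_inv_even tP) // => x; rewrite inE.
rewrite -cardsT -[[set: T]](_ : [set x | predT #|class x|] = _); last first.
  by apply/setP => x; rewrite !inE.
rewrite (card_class_sum predT) -muln2 big_distrl /=; apply: eq_big => [K|K KC].
  by rewrite andbT.
by rewrite muln2 even_halfK ?class_even.
Qed.
End Components.

(** * Insertion of a base pair *)

Section Insertion.
Variable T : finType.
Local Notation U := (option (option T)).

(** Adds one base pair: [None] and [Some None] are the points p and q of the overview. *)
Definition ext (t : T -> T) (u : U) : U :=
  match u with
  | None => Some None
  | Some None => None
  | Some (Some y) => Some (Some (t y))
  end.

(* The two new points [None] and [Some None] are matched together, or inserted
   in the edge from [x] to [s x], the first one next to [x]. *)
Definition ins (s : T -> T) (o : option T) (u : U) : U :=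
  if o is Some x then
    match u with
    | None => Some (Some x)
    | Some None => Some (Some (s x))
    | Some (Some y) =>
        if y == x then None else if y == s x then Some None
        else Some (Some (s y))
    end
  else ext s u.

Definition ins_point (s : U -> U) : option T :=
  if s None is Some (Some x) then Some x else None.

(** A point matched with one new point is rematched with the partner of the other. The default [y]
    is never reached when [s] is a fixed-point-free involution. *)
Definition ins_rest (s : U -> U) (y : T) : T :=
  match s (Some (Some y)) with
  | Some (Some z) => z
  | Some None => if s None is Some (Some z) then z else y
  | None => if s (Some None) is Some (Some z) then z else y
  end.

Lemma fpf_ext t : fpf_inv t -> fpf_inv (ext t).
Proof.
case/fpf_invP => tN tK; apply/fpf_invP; split=> [] [[y|]|] //=; last by rewrite tK.
by apply: contra (tN y) => /eqP[->].
Qed.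

Lemma fpf_ins s o : fpf_inv s -> fpf_inv (ins s o).
Proof.
case: o => [x|]; last exact: fpf_ext.
case/fpf_invP => sN sK; apply/fpf_invP; split=> [] [[y|]|] //=.
- by case: (y == x) => //; case: (y == s x) => //; apply: contra (sN y) => /eqP[->].
- case: (y =P x) => [->//|yx]; case: (y =P s x) => [->//|ysx] /=.
  rewrite (can2_eq sK sK) (introF eqP ysx) (inj_eq (can_inj sK)) (introF eqP yx).
  by rewrite sK.
- by rewrite (negPf (sN x)) eqxx.
by rewrite eqxx.
Qed.

Lemma ins_pointK s o : ins_point (ins s o) = o.
Proof. by case: o. Qed.

Lemma ins_restK s o : fpf_inv s -> ins_rest (ins s o) =1 s.
Proof.
case/fpf_invP => sN sK y; rewrite /ins_rest; case: o => [x|] //=.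
by case: eqP => [->//|_]; case: eqP => [->|//]; rewrite sK.
Qed.

Lemma insK s : fpf_inv s -> ins (ins_rest s) (ins_point s) =1 s.
Proof.
case/fpf_invP => sN sK; rewrite /ins_point.
case s0: (s None) => [[x|]|]; last by have := sN None; rewrite s0.
- have sx : s (Some (Some x)) = None by rewrite -s0 sK.
  case s1: (s (Some None)) => [[x'|]|]; last 2 first.
  + by have := sN (Some None); rewrite s1.
  + by have := sK (Some None); rewrite s1 s0.
  have sx' : s (Some (Some x')) = Some None by rewrite -s1 sK.
  have rx : ins_rest s x = x' by rewrite /ins_rest sx s1.
  move=> [[y|]|] /=; rewrite ?rx ?s0 ?s1 //.
  case: eqP => [->//|yx]; case: eqP => [->//|yx'].
  rewrite /ins_rest; case sy: (s (Some (Some y))) => [[z|]|] //.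
    by have := sK (Some (Some y)); rewrite sy s1 => -[] /esym.
  by have := sK (Some (Some y)); rewrite sy s0 => -[] /esym.
have s1 : s (Some None) = None by rewrite -s0 sK.
move=> [[y|]|] //=; rewrite /ins_rest; case sy: (s (Some (Some y))) => [[z|]|] //.
  by have := sK (Some (Some y)); rewrite sy s1.
by have := sK (Some (Some y)); rewrite sy s0.
Qed.

Lemma fpf_ins_rest s : fpf_inv s -> fpf_inv (ins_rest s).
Proof.
move=> sP; have [sN sK] := fpf_invP _ sP.
have sI := can_inj sK.
apply/fpf_invP; split=> y; rewrite /ins_rest.
- case sy: (s (Some (Some y))) => [[z|]|].
  + by apply: contra (sN (Some (Some y))) => /eqP zy; rewrite sy zy.
  + case s0: (s None) => [[z|]|]; last 2 first.
    * by have := sI _ _ (etrans s0 (esym sy)).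
    * by have := sN None; rewrite s0.
    apply/eqP => zy; have := sK None; rewrite s0 zy sy //.
  case s1: (s (Some None)) => [[z|]|].
  + by apply/eqP => zy; have := sK (Some None); rewrite s1 zy sy.
  + by have := sN (Some None); rewrite s1.
  by have := sI _ _ (etrans s1 (esym sy)).
case sy: (s (Some (Some y))) => [[z|]|].
- by rewrite -sy sK.
- case s0: (s None) => [[z|]|]; last 2 first.
  + by have := sI _ _ (etrans s0 (esym sy)).
  + by have := sN None; rewrite s0.
  by rewrite -s0 sK -sy sK.
case s1: (s (Some None)) => [[z|]|].
- by rewrite -s1 sK -sy sK.
- by have := sN (Some None); rewrite s1.
by have := sI _ _ (etrans s1 (esym sy)).
Qed.

(** [ins] is a bijection from pairs [(s, o)] with [s] a fixed-point-free involution onto the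
    fixed-point-free involutions of [U], with inverse given by [ins_rest] and [ins_point]. The count
    is sorted by the first component. *)
Lemma card_fpf_ins (Q : pred {ffun U -> U}) :
  #|[set s : {ffun U -> U} | fpf_inv s && Q s]| =
  \sum_(s : {ffun T -> T} | fpf_inv s) #|[set o | Q (finfun (ins s o))]|.
Proof.
under [RHS]eq_bigr => s _ do rewrite -sum1dep_card.
rewrite pair_big_dep -sum1dep_card /=.
pose h (p : {ffun T -> T} * option T) : {ffun U -> U} := finfun (ins p.1 p.2).
pose h' (s : {ffun U -> U}) : {ffun T -> T} * option T :=
  (finfun (ins_rest s), ins_point s).
have hE p : h p =1 ins p.1 p.2 by exact: ffunE.
rewrite (reindex_onto h h') => [|s /andP[sP _]]; last first.
  apply/ffunP => u; rewrite hE /= -[RHS]insK //.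
  have rE : finfun (ins_rest s) =1 ins_rest s by exact: ffunE.
  by rewrite /ins; case: (ins_point s) => [x|]; case: u => [[y|]|] //=; rewrite !rE.
apply: eq_bigl => -[s o]; rewrite andbAC -/(h (s, o)); congr (_ && _).
rewrite (eq_fpf_inv (hE _)) /=; apply/andP/idP => [[hP /eqP[<- _]]|sP].
  rewrite (eq_fpf_inv (ffunE _)); apply: fpf_ins_rest.
  by rewrite (eq_fpf_inv (hE _)).
split; first exact: fpf_ins.
apply/eqP; congr (_, _); last by rewrite /ins_point hE [RHS](esym (ins_pointK s o)).
apply/ffunP => y; rewrite ffunE -[RHS](ins_restK o sP).
by rewrite /ins_rest !hE.
Qed.

End Insertion.

(** * Effect of an insertion on the components *)

Definition osize (T : finType) (t s : T -> T) (o : option T) : nat :=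
  if o is Some x then #|[set y | connect (edge t s) x y]| else 0.

Section InsertionType.
Variables (T : finType) (t s : T -> T) (o : option T).
Hypotheses (tP : fpf_inv t) (sP : fpf_inv s).
Local Notation U := (option (option T)).
Local Notation e := (edge t s).
Local Notation eU := (edge (ext t) (ins s o)).

(** [None] acts as an extra component of size 0, which the new pair enlarges when its two points are
    matched together. Both kinds of insertion thus become one case. *)
Definition oconnect (a b : option T) : bool :=
  match a, b with
  | Some x, Some y => connect e x y
  | None, None => true
  | _, _ => false
  end.

Lemma oconnect_refl a : oconnect a a.
Proof. by case: a => //= x; apply: connect0. Qed.

Lemma oconnect_trans : transitive oconnect.
Proof. by move=> [y|] [x|] [z|] //=; apply: connect_trans. Qed.

Lemma oconnect_sym : symmetric oconnect.
Proof. by move=> [x|] [y|] //=; apply: connect_edge_sym. Qed.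

(* Contracts the two new points onto the ends of the edge they subdivide. *)
Definition contract (u : U) : option T :=
  match u with
  | None => o
  | Some None => omap s o
  | Some (Some y) => Some y
  end.

Lemma connect_s x : connect e x (s x).
Proof. by apply: connect1; rewrite /edge /= eqxx orbT. Qed.

Lemma connect_t x : connect e x (t x).
Proof. by apply: connect1; rewrite /edge /= eqxx. Qed.

Lemma oconnect_s a : oconnect a (omap s a).
Proof. by case: a => //= x; apply: connect_s. Qed.

(** Subdividing an edge does not change connectivity: contraction sends each edge to a path, and
    each old edge lifts to a path. *)
Lemma connect_ins u v : connect eU u v = oconnect (contract u) (contract v).
Proof.
have [sN sK] := fpf_invP _ sP.
have csym := connect_edge_sym (fpf_ext tP) (fpf_ins o sP).
have cS a : connect eU a (ins s o a) by apply: connect1; rewrite /edge /= eqxx orbT.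
have cT a : connect eU a (ext t a) by apply: connect1; rewrite /edge /= eqxx.
apply/idP/idP.
  case/connectP => p + ->; elim: p u => [|w p IHp] u /=; first by rewrite oconnect_refl.
  case/andP => uw /IHp; apply: oconnect_trans.
  case/orP: uw => /eqP->{w p IHp}.
    case: u => [[y|]|] /=; [exact: connect_t| |exact: oconnect_s].
    by rewrite oconnect_sym oconnect_s.
  rewrite /ins /contract; case: o => [x|]; case: u => [[y|]|] //=; try exact: connect0.
    case: (y =P x) => [->|_]; first exact: connect0.
    by case: (y =P s x) => [->|_] /=; [exact: connect0|exact: connect_s].
  exact: connect_s.
have cP x : o = Some x -> connect eU None (Some (Some x)).
  by move=> ox; have := cS None; rewrite {2}ox.
have cQ x : o = Some x -> connect eU (Some None) (Some (Some (s x))).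
  by move=> ox; have := cS (Some None); rewrite {2}ox.
have cPQ := cT None.
(* Old edges survive, except the one between [x] and [s x], which is replaced by the path [x],
   [None], [Some None], [s x]. *)
have lift y z : connect e y z -> connect eU (Some (Some y)) (Some (Some z)).
  apply: (connect_homo (f := fun y => Some (Some y))) => {}y {}z /orP[] /eqP->.
    exact: (cT (Some (Some y))).
  have := cS (Some (Some y)).
  have [o0|[x ox]] : o = None \/ exists x, o = Some x by case: o => [x|]; eauto.
    by rewrite {2}o0.
  rewrite {2}ox /=; case: (y =P x) => [-> _|_].
    by apply: connect_trans (cQ _ ox); apply: connect_trans cPQ; rewrite csym cP.
  case: (y =P s x) => [-> _|//]; rewrite sK; apply: connect_trans (cP _ ox).
  by rewrite csym; apply: connect_trans (cQ _ ox).
have toC w y : contract w = Some y -> connect eU w (Some (Some y)).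
  case: w => [[z|]|] /=; [by case=> -> | | exact: cP].
  have [->//|[x ox]] : o = None \/ exists x, o = Some x by case: o => [x|]; eauto.
  by rewrite {1}ox => -[<-]; apply: cQ.
case Eu: (contract u) => [y|]; case Ev: (contract v) => [z|] //=.
  move/lift => yz; apply: connect_trans (toC _ _ Eu) (connect_trans yz _).
  by rewrite csym; apply: toC.
move=> _; have new w : contract w = None -> connect eU None w.
  by case: w => [[w|]|].
by apply: connect_trans (new _ Ev); rewrite csym; apply: new.
Qed.

Lemma card_option2 (P : pred U) :
  #|[set u | P u]| = P None + P (Some None) + #|[set y | P (Some (Some y))]|.
Proof.
rewrite (cardsD1 None) (cardsD1 (Some None)) !inE /= addnA; congr (_ + _).
have inj : injective (fun y : T => Some (Some y)) by move=> x y [].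
rewrite -(card_imset _ inj); apply: eq_card => u; rewrite !inE.
apply/and3P/imsetP => [|[y]]; last by rewrite inE => ? ->.
by case: u => [[y|]|] [] // _ _ Py; exists y; rewrite ?inE.
Qed.

(** The two new points contract to the ends of one edge, so they join the same class, that of [o],
    and no other class gains points. *)
Lemma card_class_ins u :
  #|[set v | connect eU u v]| =
    osize t s (contract u) + (oconnect (contract u) o).*2.
Proof.
have -> : [set v | connect eU u v] = [set v | oconnect (contract u) (contract v)].
  by apply/setP => v; rewrite !inE connect_ins.
rewrite (card_option2 (fun v => oconnect (contract u) (contract v))) /=.
have -> : oconnect (contract u) (omap s o) = oconnect (contract u) o.
  apply/idP/idP => h; apply: oconnect_trans h _; last exact: oconnect_s.
  by rewrite oconnect_sym oconnect_s.
rewrite addnn addnC; congr (_ + _).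
case: (contract u) => [y|] //=.
by apply: eq_card0 => z; rewrite !inE.
Qed.

Lemma osize_oconnect a b : oconnect a b -> osize t s a = osize t s b.
Proof.
by case: a b => [x|] [y|] //= /(class_eqP tP sP) ->.
Qed.

Lemma osize_even : odd (osize t s o) = false.
Proof. by case: o => //= x; apply: (class_even tP); apply: imset_f. Qed.

(** After multiplication by [j.*2] both sides count points. Outside the component [A] of [o] class
    sizes are unchanged; the points of [A] pass from size [#|A|] to size [#|A| + 2], which is also
    the size seen by the two new points. *)
Lemma grown_ins :
  grown (osize t s o)./2 (ctype t s) (ctype (ext t) (ins s o)).
Proof.
move=> j j0; apply/eqP; rewrite -(@eqn_pmul2l j.*2) ?double_gt0 // !mulnDr.
rewrite -!count_ctype ?fpf_ext ?fpf_ins //; apply/eqP.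
rewrite (card_option2 (fun u => #|[set v | connect eU u v]| == j.*2)).
rewrite !card_class_ins /= oconnect_refl (oconnect_sym (omap s o)) oconnect_s.
rewrite (osize_oconnect (b := o)); last by rewrite oconnect_sym oconnect_s.
pose A := [set y | oconnect (Some y) o].
have cA : #|A| = osize t s o.
  rewrite /A; case: o => [x|] /=; last by apply: eq_card0 => y; rewrite inE.
  by apply: eq_card => y; rewrite !inE connect_edge_sym.
have sizeA y : y \in A -> #|[set z | connect e y z]| = #|A|.
  by rewrite inE => /osize_oconnect; rewrite cA.
set B := [set y | _]; set D := [set y | _].
have inA y : y \in A -> oconnect (Some y) o by rewrite inE.
have cBA : #|B :&: A| = (#|A| + 2 == j.*2) * #|A|.
  have -> : B :&: A = if #|A| + 2 == j.*2 then A else set0.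
    apply/setP => y; rewrite in_setI; case yA: (y \in A); last first.
      by rewrite andbF; case: ifP => _; rewrite ?yA ?inE.
    rewrite inE card_class_ins /= -/(oconnect (Some y) o) inA // sizeA //.
    by case: ifP => _; rewrite ?yA ?inE.
  by case: ifP; rewrite ?mul1n // cards0.
have cDA : #|D :&: A| = (#|A| == j.*2) * #|A|.
  have -> : D :&: A = if #|A| == j.*2 then A else set0.
    apply/setP => y; rewrite in_setI; case yA: (y \in A); last first.
      by rewrite andbF; case: ifP => _; rewrite ?yA ?inE.
    by rewrite inE sizeA //; case: ifP => _; rewrite ?yA ?inE.
  by case: ifP; rewrite ?mul1n // cards0.
have cBD : #|B :\: A| = #|D :\: A|.
  apply: eq_card => y; rewrite !in_setD; case yA: (y \in A) => //=.
  rewrite !inE card_class_ins /= -/(oconnect (Some y) o).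
  by move: yA; rewrite inE => ->; rewrite addn0.
rewrite -(cardsID A B) -(cardsID A D) cBA cDA cBD cA /=.
(* Writing the even number [osize t s o] as [2k], the points of [A] and the new ones contribute
   [2k + 2] exactly when [j = k + 1], and the lost ones [2k] exactly when [j = k]. *)
by have := osize_even; case: eqP; case: eqP; case: eqP; case: eqP => /=; nia.
Qed.
End InsertionType.

(** * Pair partitions as involutions *)

Section Transfer.
Variables (T V : finType) (h : V -> T) (h' : T -> V).
Hypotheses (hK : cancel h h') (h'K : cancel h' h).
Variables (t : T -> T) (tV : V -> V).
Hypotheses (tP : fpf_inv t) (tE : forall u, t (h u) = h (tV u)).

Lemma fpf_conj (s : T -> T) (sV : V -> V) :
  (forall u, s (h u) = h (sV u)) -> fpf_inv s = fpf_inv sV.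
Proof.
move=> sE; apply/fpf_invP/fpf_invP => -[sN sK]; split=> x.
- by rewrite -(inj_eq (can_inj hK)) -sE.
- by apply: (can_inj hK); rewrite -!sE.
- by rewrite -(h'K x) sE (inj_eq (can_inj hK)).
- by rewrite -(h'K x) !sE sK.
Qed.

Lemma connect_conj (s : T -> T) (sV : V -> V) u v :
  (forall u, s (h u) = h (sV u)) ->
  connect (edge t s) (h u) (h v) = connect (edge tV sV) u v.
Proof.
move=> sE; apply/idP/idP.
  rewrite -{2}(hK u) -{2}(hK v); apply: connect_homo => x y.
  have tE' : h' (t x) = tV (h' x) by rewrite -{1}[x]h'K tE hK.
  have {}sE : h' (s x) = sV (h' x) by rewrite -{1}[x]h'K sE hK.
  by case/orP => /eqP->; apply: connect1; rewrite /edge /= ?tE' ?sE eqxx ?orbT.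
apply: connect_homo => x y /orP[] /eqP->; apply: connect1.
  by rewrite /edge /= tE eqxx.
by rewrite /edge /= sE eqxx orbT.
Qed.

(** Multiplicities are compared by counting points in classes of a given size, and [h] maps classes
    bijectively to classes. *)
Lemma ctype_conj (s : T -> T) (sV : V -> V) :
  fpf_inv s -> (forall u, s (h u) = h (sV u)) -> ctype t s = ctype tV sV.
Proof.
move=> sP sE.
have tVP : fpf_inv tV by rewrite -(fpf_conj tE).
have sVP : fpf_inv sV by rewrite -(fpf_conj sE).
apply: sorted_count_eq; rewrite ?sorted_ctype ?ctype_pos // => j j0.
apply/eqP; rewrite -(@eqn_pmul2l j.*2) ?double_gt0 // -!count_ctype //.
rewrite -(card_imset _ (can_inj hK)).
have card_cl u : #|[set x | connect (edge t s) (h u) x]| =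
                 #|[set v | connect (edge tV sV) u v]|.
  rewrite -[RHS](card_imset _ (can_inj hK)); congr #|pred_of_set _|.
  apply/setP => x; rewrite inE -[in LHS](h'K x) (connect_conj _ _ sE).
  by rewrite -[in RHS](h'K x) mem_imset ?inE //; apply: can_inj hK.
apply/eqP/eq_card => x; rewrite -(h'K x) mem_imset; last exact: can_inj hK.
by rewrite !inE card_cl.
Qed.

Lemma card_fpf_conj (la : seq nat) :
  #|[set s : {ffun T -> T} | fpf_inv s && (ctype t s == la)]| =
  #|[set s : {ffun V -> V} | fpf_inv s && (ctype tV s == la)]|.
Proof.
pose c (s : {ffun T -> T}) : {ffun V -> V} := [ffun u => h' (s (h u))].
pose c' (s : {ffun V -> V}) : {ffun T -> T} := [ffun x => h (s (h' x))].
have cK : cancel c c' by move=> s; apply/ffunP => x; rewrite !ffunE !h'K.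
have c'K : cancel c' c by move=> s; apply/ffunP => x; rewrite !ffunE !hK.
rewrite -[RHS](on_card_preimset (f := c)); last exact/onW_bij/(Bijective cK c'K).
apply: eq_card => s; rewrite !inE.
have sE u : s (h u) = h (c s u) by rewrite ffunE h'K.
rewrite -(fpf_conj sE); case sP: (fpf_inv s) => //=.
by rewrite -(ctype_conj sP sE).
Qed.
End Transfer.

Section Matching.
Variable T : finType.

Definition graph_blocks (s : T -> T) : {set {set T}} :=
  [set [set x; s x] | x : T].

Lemma mem_graph_blocks s x y : fpf_inv s ->
  ([set x; y] \in graph_blocks s) = (y == s x).
Proof.
case/fpf_invP => sN sK; apply/imsetP/eqP => [[z _ e]|->]; last by exists x.
have : x \in [set z; s z] by rewrite -e !inE eqxx.
rewrite !inE => /orP[] /eqP xE; subst x.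
  have : s z \in [set z; y] by rewrite e !inE eqxx orbT.
  by rewrite !inE (negPf (sN z)) => /eqP.
have : z \in [set s z; y] by rewrite e !inE eqxx.
by rewrite !inE eq_sym (negPf (sN z)) sK => /eqP.
Qed.

Lemma graph_blocks_partner s B : fpf_inv s -> B \in graph_blocks s ->
  forall x, x \in B -> B = [set x; s x].
Proof.
case/fpf_invP=> sN sK /imsetP[z _ ->] x; rewrite !inE => /orP[] /eqP-> //.
by rewrite sK setUC.
Qed.

Lemma partition_graph_blocks s :
  fpf_inv s -> partition (graph_blocks s) [set: T].
Proof.
move=> sP; have [sN sK] := fpf_invP _ sP; apply/and3P; split.
- rewrite eqEsubset subsetT; apply/subsetP => x _; apply/bigcupP.
  by exists [set x; s x]; [exact: imset_f | rewrite !inE eqxx].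
- apply/trivIsetP => A B AG BG; apply: contraR => /pred0Pn[x /andP[xA xB]].
  by rewrite (graph_blocks_partner sP AG xA) (graph_blocks_partner sP BG xB).
by apply/imsetP => -[x _ /setP/(_ x)]; rewrite !inE eqxx.
Qed.

Lemma card_graph_blocks_mem s B :
  fpf_inv s -> B \in graph_blocks s -> #|B| = 2.
Proof.
by case/fpf_invP=> sN _ /imsetP[x _ ->]; rewrite cards2 eq_sym sN.
Qed.

Lemma card_graph_blocks s : fpf_inv s -> #|graph_blocks s|.*2 = #|T|.
Proof.
move=> sP; rewrite -cardsT -muln2; apply/esym/card_uniform_partition.
  by move=> B; apply: card_graph_blocks_mem.
exact: partition_graph_blocks.
Qed.

Lemma graph_blocks_surj (P : {set {set T}}) :
  partition P [set: T] -> {in P, forall B : {set T}, #|B| = 2} ->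
  exists2 s : {ffun T -> T}, fpf_inv s & graph_blocks s = P.
Proof.
move=> partP P2; have /and3P[/eqP covP trivP P0] := partP.
have cov x : x \in cover P by rewrite covP.
(* The partner of [x] is the other element of its block; the default [x] does not occur, since a
   block has two elements. *)
pose s := [ffun x => odflt x [pick y in pblock P x | y != x]].
have sE x : s x != x /\ pblock P x = [set x; s x].
  have := P2 _ (pblock_mem (cov x)); have : x \in pblock P x by rewrite mem_pblock.
  rewrite ffunE; case: pickP => [y /andP[yB yx] xB cB|none xB cB]; last first.
    have : pblock P x \subset [set x].
      apply/subsetP => y yB; have := none y; rewrite /= yB inE.
      by move/negbFE.
    by move/subset_leq_card; rewrite cB cards1.
  split=> //; apply/eqP; rewrite eq_sym eqEcard cB cards2 eq_sym yx andbT.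
  by apply/subsetP => z; rewrite !inE => /orP[] /eqP->.
have sP : fpf_inv s.
  apply/fpf_invP; split=> x; first by have [] := sE x.
  have [sx Bx] := sE x; have [ssx Bsx] := sE (s x).
  have : s x \in pblock P x by rewrite Bx !inE eqxx orbT.
  rewrite -eq_pblock // => /eqP Bxs.
  have : s (s x) \in pblock P x by rewrite Bxs Bsx !inE eqxx orbT.
  by rewrite Bx !inE (negPf ssx) orbF => /eqP.
exists s => //; apply/setP => B; apply/imsetP/idP => [[x _ ->]|BP].
  by have [_ <-] := sE x; apply: pblock_mem.
have /card_gt0P[x xB] : 0 < #|B| by rewrite P2.
by exists x => //; have [_ <-] := sE x; rewrite (def_pblock trivP BP xB).
Qed.

Lemma graph_blocks_inj (s1 s2 : {ffun T -> T}) :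
  fpf_inv s1 -> fpf_inv s2 -> graph_blocks s1 = graph_blocks s2 -> s1 = s2.
Proof.
move=> sP1 sP2 e; apply/ffunP => x; apply/eqP.
by rewrite -(mem_graph_blocks _ _ sP2) -e mem_graph_blocks.
Qed.
End Matching.

(** * The base pairs as an involution *)

Lemma swap_subproof m (x : 'I_m.*2) : (if odd x then x.-1 else x.+1) < m.*2.
Proof. by have := ltn_ord x; case: ifP; lia. Qed.

Definition swap m (x : 'I_m.*2) : 'I_m.*2 := Ordinal (swap_subproof x).

Lemma fpf_swap m : fpf_inv (@swap m).
Proof.
apply/fpf_invP; split=> x.
  by rewrite -val_eqE /=; case: ifP; lia.
by apply: val_inj; rewrite /=; case xo: (odd x); case: ifP; lia.
Qed.

(** Relabels the points so that the last base pair, [m.*2] and [m.*2.+1], becomes the pair [None],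
    [Some None] added by [ext]. *)
Lemma card_fpf_swapS m (la : seq nat) :
  #|[set s : {ffun 'I_m.+1.*2 -> 'I_m.+1.*2} |
       fpf_inv s && (ctype (@swap m.+1) s == la)]| =
  #|[set s : {ffun option (option 'I_m.*2) -> option (option 'I_m.*2)} |
       fpf_inv s && (ctype (ext (@swap m)) s == la)]|.
Proof.
pose h (u : option (option 'I_m.*2)) : 'I_m.+1.*2 :=
  match u with
  | None => inord m.*2
  | Some None => inord m.*2.+1
  | Some (Some x) => inord x
  end.
have hE u : val (h u) = match u with None => m.*2 | Some None => m.*2.+1
                        | Some (Some x) => val x end.
  case: u => [[x|]|] /=; rewrite inordK //.
  exact: leq_trans (ltn_ord x) (leqW (leqnSn _)).
have hI : injective h.
  move=> u v /(congr1 val); rewrite !hE.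
  case: u v => [[x|]|] [[y|]|] //=.
  all: try have := ltn_ord x.
  all: try have := ltn_ord y.
  all: try lia.
  by move=> _ _ /val_inj->.
have [h' hK h'K] : bijective h.
  by apply: inj_card_bij => //; rewrite !card_option !card_ord.
apply: (card_fpf_conj hK h'K (fpf_swap m.+1)) => u.
apply: val_inj; rewrite [LHS]/= -[nat_of_ord (h u)]/(val (h u)) !hE.
by case: u => [[x|]|] //=; case: ifP; rewrite /= ?odd_double; lia.
Qed.

Lemma mem_base_pairs m (x y : 'I_m.*2) :
  ([set x; y] \in [seq base_pair k | k <- enum 'I_m]) = (y == swap x).
Proof.
apply/mapP/eqP => [[k _ e]|->]; last first.
  have ltk : x./2 < m by have := ltn_ord x; lia.
  exists (Ordinal ltk); rewrite ?mem_enum //; apply/setP => z.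
  by rewrite !inE -!val_eqE /=; case: ifP; lia.
have Ez z : (z == x) || (z == y) = (z == k.*2 :> nat) || (z == k.*2.+1 :> nat).
  by move/setP/(_ z): e; rewrite !inE.
have lt0 : k.*2 < m.*2 by have := ltn_ord k; lia.
have lt1 : k.*2.+1 < m.*2 by have := ltn_ord k; lia.
(* Testing membership at the four points involved leaves a purely arithmetical claim. *)
have := Ez x; have := Ez y; have := Ez (Ordinal lt0); have := Ez (Ordinal lt1).
rewrite -!val_eqE /= !eqxx !orbT => H0 H1 H2 H3.
by apply: val_inj => /=; case: ifP; lia.
Qed.

Lemma adjacent_graph_blocks m (s : 'I_m.*2 -> 'I_m.*2) : fpf_inv s ->
  adjacent (graph_blocks s) =2 edge (@swap m) s.
Proof.
move=> sP x y.
by rewrite /adjacent mem_cat mem_base_pairs mem_enum mem_graph_blocks.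
Qed.

Lemma coset_type_graph_blocks m (s : 'I_m.*2 -> 'I_m.*2) : fpf_inv s ->
  coset_type (graph_blocks s) = ctype (@swap m) s.
Proof.
move=> sP; rewrite /coset_type /ctype; congr (sort _ [seq _ | _ in pred_of_set _]).
apply: eq_imset => x; apply/setP => y; rewrite !inE.
exact/eq_connect/adjacent_graph_blocks.
Qed.

(** [graph_blocks] is a bijection from fixed-point-free involutions onto pair partitions, and it
    carries [ctype] to [coset_type]. *)
Lemma C_fpf m (la : intpart m) :
  C la = #|[set s : {ffun 'I_m.*2 -> 'I_m.*2} |
              fpf_inv s && (ctype (@swap m) s == la)]|.
Proof.
rewrite /C -[RHS](card_in_imset (f := fun s : {ffun _ -> _} => graph_blocks s)); last first.
  move=> s1 s2; rewrite !inE => /andP[sP1 _] /andP[sP2 _]; exact: graph_blocks_inj.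
apply: eq_card => P; rewrite inE; apply/andP/imsetP.
  case=> /and3P[partP _ /forall_inP P2] tP.
  have [|s sP sE] := graph_blocks_surj partP; first by move=> B /P2/eqP.
  by exists s; rewrite // inE sP -coset_type_graph_blocks // sE.
case=> s; rewrite inE => /andP[sP tP] ->; split; last by rewrite coset_type_graph_blocks.
apply/and3P; split; first exact: partition_graph_blocks.
  by rewrite -(inj_eq double_inj) card_graph_blocks // card_ord.
by apply/forall_inP => B /card_graph_blocks_mem ->.
Qed.

(** * Counting the insertions and the recurrence *)

Lemma ctype_intpart m (s : 'I_m.*2 -> 'I_m.*2) :
  fpf_inv s -> is_intpart m (ctype (@swap m) s).
Proof.
move=> sP; apply/and3P; split; [exact: sorted_ctype | |].
  by rewrite ctype_pos // fpf_swap.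
by rewrite sumn_ctype ?fpf_swap // card_ord doubleK.
Qed.

(** The new coset-type is [mu] with the half-size of the component of [o] grown. In the converse
    direction [la] is a growth of [mu] by the same part, hence has the same multiplicities. *)
Lemma ctype_insE m (s : 'I_m.*2 -> 'I_m.*2) o (mu : intpart m) (la : intpart m.+1) :
  fpf_inv s -> ctype (@swap m) s = mu ->
  (ctype (ext (@swap m)) (ins s o) == la) =
  diag_sub mu la && (nth 0 mu (added_row mu la) == (osize (@swap m) s o)./2).
Proof.
move=> sP muE; have gr := grown_ins o (fpf_swap m) sP; rewrite muE in gr.
apply/eqP/andP => [e|[dmu /eqP nmu]].
  by rewrite e in gr; have /grownP[-> ->] := gr.
have /and3P[las la0 _] := intpartP la.
apply: sorted_count_eq => //; first exact: sorted_ctype.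
  exact: ctype_pos (fpf_ext (fpf_swap m)) (fpf_ins o sP).
have /grownP gr' := conj dmu nmu.
move=> j j0; apply/eqP; rewrite -(eqn_add2r ((osize (@swap m) s o)./2 == j)).
by rewrite gr // gr'.
Qed.

(** With [k] the part of [mu] to be raised, the admissible [o] are the points in components of
    half-size [k] if [k] is positive. If [k = 0] only [None] qualifies, since components are
    nonempty. *)
Lemma card_ins_ctype m (s : 'I_m.*2 -> 'I_m.*2) (mu : intpart m)
    (la : intpart m.+1) :
  fpf_inv s -> ctype (@swap m) s = mu ->
  #|[set o | ctype (ext (@swap m)) (ins s o) == la]| =
    if diag_sub mu la then mult mu la else 0.
Proof.
move=> sP muE.
have -> : [set o | ctype (ext (@swap m)) (ins s o) == la] = [set o |
    diag_sub mu la && (nth 0 mu (added_row mu la) == (osize (@swap m) s o)./2)].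
  by apply/setP => o; rewrite !inE (ctype_insE _ _ sP muE).
case: (diag_sub mu la); last by apply: eq_card0 => o; rewrite inE.
pose cl x := [set y | connect (edge (@swap m) s) x y].
have cC x : cl x \in [set cl x | x : _] by exact: imset_f.
rewrite /mult; set k := nth 0 mu _; case: ltnP => [k0|].
  rewrite -muE mul2n -count_ctype ?fpf_swap //.
  rewrite -[RHS](card_imset _ (@Some_inj _)); apply: eq_card => -[x|].
    rewrite mem_imset; last exact: Some_inj.
    rewrite !inE /=; have := class_even (fpf_swap m) (cC x).
    by rewrite /cl; lia.
  rewrite !inE /= gtn_eqF //; symmetry; apply/negP; case/imsetP=> x //.
rewrite leqn0 => /eqP ->; rewrite -(cards1 (None : option 'I_m.*2)).
apply: eq_card => -[x|]; rewrite !inE //=.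
by rewrite ltn_eqF ?(class_pos (fpf_swap m) sP (cC x)).
Qed.

Theorem theorem5p1 (n : nat) (hn : 2 <= n) (la : intpart n) :
  C la = \sum_(mu : intpart n.-1 | diag_sub mu la) mult mu la * C mu.
Proof.
case: n la hn => [|m] la // _; rewrite [m.+1.-1]/=.
rewrite C_fpf card_fpf_swapS card_fpf_ins.
under eq_bigr => s _.
  under eq_finset => o do rewrite (eq_ctype _ (ffunE _)).
  over.
under [RHS]eq_bigr => mu _ do rewrite C_fpf -sum1dep_card big_distrr /=.
(* Summing over involutions first, each [s] meets only one [mu], its own coset-type, and the weight
   of that [mu] is its number of insertions giving [la]. *)
rewrite (exchange_big_dep (fun s : {ffun _ -> _} => fpf_inv s)) /=; last first.
  by move=> mu s _ /andP[].
apply: eq_bigr => s sP; pose mu := IntPart (ctype_intpart sP).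
rewrite (card_ins_ctype (mu := mu)) // big_mkcondl (big_pred1 mu) ?muln1 //.
by move=> mu'; rewrite sP; apply/eqP/eqP => [e|->] //; apply: val_inj.
Qed.
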